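(* Let $f\colon X\rightharpoonup X$ be a partial map on a metric space $(X,d)$, let $a<b$ be non-negative integers, and let $F\colon D_F\rightharpoonup D_F$ be the restriction of the time extension of $f$ to $D_F\subseteq \{a,a+1,\dots,b\}\times X$, where $D_F$ is equipped with the cost function $c_d$ associated with $d$. Let $G,B \subset \{b \} \times X = D_{F} - \operatorname{dom}F$ be subsets with $G \sqcup B = \{b \} \times X$ (disjoint union). Then for any $\varepsilon \in [0,\infty)$, we have $G_{F,\varepsilon_\Sigma} \sqcup B_{F,-\varepsilon_\Sigma} = D_F$ (disjoint union), where for $\varepsilon=0$ the set $B_{F,-\varepsilon_\Sigma}$ means $B_{F,-0_\Sigma}$.
   Context: A partial map $f\colon X\rightharpoonup X$ is a map from a subset $\operatorname{dom}f\subseteq X$ to $X$. Time extension: put $Y:=\{a,a+1,\dots,b\}\times X$ and let $\widetilde f\colon Y\rightharpoonup Y$, $\widetilde f(t,x):=(t+1,f(x))$, be defined for $t\le b-1$ and $x\in\operatorname{dom}f$. Let $D_F:=\{(b-n,x)\in Y\mid n\in\{0,1,\dots,b-a\},\ f^n(x)\text{ is defined (i.e. } f^n(x)\in X)\}$ and let $F:=\widetilde f|_{D_F}\colon D_F\rightharpoonup D_F$. Then $\operatorname{dom}F=D_F-(\{b\}\times X)$, so $D_F-\operatorname{dom}F=\{b\}\times X$. Cost function associated with $d$: $c_d\colon D_F\times D_F\to[0,\infty]$, $c_d((t,x),(t',x')):=d(x,x')$ if $t=t'$ and $:=\infty$ if $t\ne t'$. Reachable sets (with $c=c_d$): for $\varepsilon\in[0,\infty]$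 and $y\in D_F$, the set $[y]_F^{\varepsilon_\Sigma}$ consists of $y$ itself (path of length $0$) together with all points of the form $F(y_{n-1})$, where $n\ge1$, $(y_0,\dots,y_{n-1})\in(\operatorname{dom}F)^n$, and there is $(\varepsilon_0,\dots,\varepsilon_{n-1})\in[0,\infty]^n$ with $\sum_{i=0}^{n-1}\varepsilon_i\le\varepsilon$, $c(y,y_0)\le\varepsilon_0$ and $c(F(y_i),y_{i+1})\le\varepsilon_{i+1}$ for all $0\le i\le n-2$. Attracting basins of $A\subseteq D_F$: for $\varepsilon\in[0,\infty]$, $A_{F,\varepsilon_\Sigma}:=\{y\in D_F\mid [y]_F^{\varepsilon_\Sigma}\cap A\ne\emptyset\}$; $A_{F,-0_\Sigma}:=\{y\in D_F\mid \emptyset\ne[y]_F^{0_\Sigma}\setminus\operatorname{dom}F\subseteq A\}$; and for $\varepsilon\in(0,\infty]$, $A_{F,-\varepsilon_\Sigma}:=\{y\in A_{F,-0_\Sigma}\mid\emptyset\ne[y]_F^{\varepsilon_\Sigma}\setminus\operatorname{dom}F\subseteq A\}$. *)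

(* Defs.v *)
From mathcomp Require Import all_boot all_order all_algebra.
From mathcomp Require Import all_classical all_reals all_analysis.

Set Implicit Arguments.
Unset Strict Implicit.
Unset Printing Implicit Defensive.

Import Order.TTheory GRing.Theory Num.Theory.

Local Open Scope classical_set_scope.
Local Open Scope ring_scope.

(* A partial map Z -> Z is a total map g : Z -> option Z; [g z = None] means
   that z is not in the domain. *)
Definition pdom (Z : Type) (g : Z -> option Z) : set Z :=
  [set z | exists w, g z = Some w].

(* g^n(z), equal to None when undefined; g^0 is the total identity. *)
Definition piter (Z : Type) (g : Z -> option Z) (n : nat) (z : Z) : option Z :=
  iter n (obind g) (Some z).

(* Restriction of g in both source and target: undefined at z in D as soon as
   g z is undefined or lies outside D. *)
Definition prestrict (Z : Type) (D : set Z) (g : Z -> option Z) (z : D) :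
    option D :=
  obind insub (g (val z)).

Section Reachability.
Context (R : realType) (Z : Type) (F : Z -> option Z) (c : Z -> Z -> \bar R).

(* The paths (y_0, ..., y_(n-1)) and the (eps_0, ..., eps_(n-1)) are given by
   sequences indexed by nat of which only the first n terms matter; z_i is
   F(y_i), so that [F (y_ i) = Some (z_ i)] also says that y_i is in dom F. *)
Definition reach (eps : \bar R) (y : Z) : set Z :=
  [set p | p = y \/
    exists (n : nat) (y_ z_ : nat -> Z) (eps_ : nat -> \bar R),
      [/\ (1 <= n)%N,
          forall i, (i < n)%N -> F (y_ i) = Some (z_ i),
          forall i, (i < n)%N -> (0 <= eps_ i)%E &
          (\sum_(0 <= i < n) eps_ i <= eps)%E] /\
      [/\ (c y (y_ 0%N) <= eps_ 0%N)%E,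
          forall i, (i.+1 < n)%N -> (c (z_ i) (y_ i.+1) <= eps_ i.+1)%E &
          p = z_ n.-1]].

Definition basin (A : set Z) (eps : \bar R) : set Z :=
  [set y | reach eps y `&` A !=set0].

Definition ends_inside (A : set Z) (eps : \bar R) (y : Z) : Prop :=
  reach eps y `\` pdom F !=set0 /\ reach eps y `\` pdom F `<=` A.

Definition basin_minus0 (A : set Z) : set Z := [set y | ends_inside A 0%E y].

Definition basin_minus (A : set Z) (eps : \bar R) : set Z :=
  if eps == 0%E then basin_minus0 A
  else [set y | basin_minus0 A y /\ ends_inside A eps y].

End Reachability.

Section TimeExtension.
Context (X : Type) (a b : nat) (f : X -> option X).

Definition spacetime : Type := ({t : nat | (a <= t <= b)%N} * X)%type.

(* [insub t.+1] is undefined exactly at t = b. *)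
Definition time_ext (y : spacetime) : option spacetime :=
  obind (fun t' => omap (pair t') (f y.2)) (insub (val y.1).+1).

Definition DF : set spacetime :=
  [set y | exists n : nat, [/\ (n <= b - a)%N, val y.1 = (b - n)%N &
                               exists w, piter f n y.2 = Some w]].

Definition timeF : DF -> option DF := prestrict time_ext.

Definition final_slice : set DF := [set y | val (val y).1 = b].

Lemma piterS n x : piter f n.+1 x = obind (piter f n) (f x).
Proof.
rewrite /piter iterSr /=; case: (f x) => [//|] /=.
by elim: n => //= n ->.
Qed.

Lemma setC_pdom_timeF : ~` pdom timeF = final_slice.
Proof.
apply/seteqP; split => -[[[t tP] x] yD]; rewrite /final_slice /pdom /=; last first.
  move=> tb [w]; rewrite /timeF /prestrict /time_ext /=.
  by rewrite insubF //= tb ltnn andbF.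
move=> ndom; apply/eqP; apply: contra_notT ndom => tNb.
have [n [nab /= tE [w]]] := set_mem yD.
case: n nab tE => [|n] nab tE; first by rewrite tE subn0 eqxx in tNb.
rewrite piterS; case fx: (f x) => [x'|//] /= x'w.
have nb : (n < b)%N by rewrite (leq_trans nab)// leq_subr.
have tE' : t.+1 = (b - n)%N by rewrite tE -subSn// subSS.
have t'P : (a <= t.+1 <= b)%N.
  by rewrite tE' leq_subr andbT -tE' leqW//; case/andP: (tP).
pose y' : spacetime := (exist _ t.+1 t'P, x').
have y'D : y' \in DF by apply/mem_set; exists n; split; [exact: ltnW|by []|exists w].
exists (exist _ y' y'D).
rewrite /timeF /prestrict /time_ext /= insubT /= fx /=.
rewrite (_ : (_, x') = y') ?insubT /=; first by congr Some; exact: val_inj.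
by congr pair; exact: val_inj.
Qed.

End TimeExtension.

Arguments DF {X} a b f.
Arguments timeF {X} a b f y.
Arguments final_slice {X} a b f.

Definition time_cost (R : realType) (X : metricType R) (a b : nat)
    (f : X -> option X) (y y' : DF a b f) : \bar R :=
  if val (val y).1 == val (val y').1
  then (mdist (val y).2 (val y').2)%:E else +oo%E.

Arguments time_cost {R X} a b f y y'.

(* Main.v *)
Require Import Defs.
From mathcomp Require Import all_boot all_order all_algebra.
From mathcomp Require Import all_classical all_reals all_analysis.

(** A point either can be steered into G within budget eps, or all endpoints
    it reaches lie in the complement B of G among the points outside dom F.
    What makes this a genuine dichotomy between the two basins is that the set
    of reachable endpoints is never empty: since F increases time, the orbit of
    any point, followed at cost 0, leaves dom F after finitely many steps. *)

Local Open Scope classical_set_scope.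
Local Open Scope ring_scope.

Import Order.TTheory.

Section Reach.
Context {R : realType} {Z : Type} (F : Z -> option Z) (c : Z -> Z -> \bar R).

Lemma reach_le (eps eps' : \bar R) (y : Z) :
  (eps <= eps')%E -> reach F c eps y `<=` reach F c eps' y.
Proof.
move=> le_eps p [->|[n [y_ [z_ [e_ [[n0 Fyz e0 se] cyz]]]]]]; first by left.
by right; exists n, y_, z_, e_; split=> //; split=> //; exact: le_trans le_eps.
Qed.

(** Putting [y] in front of a path from [z] costs nothing, since the jump from [y] to itself has
    cost 0, so the budget stays the same. The path of length 0 at [z] becomes the path of length 1
    through [y]. *)
Lemma reach_prepend (eps : \bar R) (y z : Z) :
    (0 <= eps)%E -> c y y = 0%E -> F y = Some z ->
  reach F c eps z `<=` reach F c eps y.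
Proof.
move=> eps0 cyy Fy p [->|zp]; right.
  exists 1%N, (fun=> y), (fun=> z), (fun=> 0%E).
  by rewrite big1 // cyy; split.
case: zp => n [y_ [z_ [e_ [[n0 Fyz e0 se] [cy cz ->]]]]].
exists n.+1, (fun i => if i is j.+1 then y_ j else y),
  (fun i => if i is j.+1 then z_ j else z),
  (fun i => if i is j.+1 then e_ j else 0%E).
split; split=> //.
- by case.
- by case.
- by rewrite big_nat_recl //= add0e.
- by rewrite cyy.
- by case=> [|i] //= lin; exact: cz.
(* The shifted endpoint has index [n]; it is [z_ n.-1] because [n] is positive. *)
- by case: n n0 {Fyz e0 se cz}.
Qed.

(** Induction on a bound for [mu]: either [y] is itself an endpoint, or an endpoint reached from its
    image is reached from [y] by prepending. *)
Lemma reach0_terminal (mu : Z -> nat) :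
    (forall y, c y y = 0%E) ->
    (forall y z, F y = Some z -> (mu z < mu y)%N) ->
  forall y, reach F c 0%E y `\` pdom F !=set0.
Proof.
move=> cyy muF y; have [m] := ubnP (mu y).
elim: m y => // m IHm y; rewrite ltnS => lt_m.
case Fy: (F y) => [z|]; last first.
  by exists y; split; [left|case=> w; rewrite Fy].
have [p [zp pF]] := IHm z (leq_trans (muF _ _ Fy) lt_m).
by exists p; split=> //; exact: reach_prepend zp.
Qed.

Lemma basin_partition (G B : set Z) (eps : \bar R) :
    (forall y, reach F c 0%E y `\` pdom F !=set0) ->
    G `|` B = ~` pdom F -> G `&` B = set0 -> (0 <= eps)%E ->
  basin F c G eps `|` basin_minus F c B eps = [set: Z] /\
  basin F c G eps `&` basin_minus F c B eps = set0.
Proof.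
move=> term GB_union GB_disj eps0.
(* The condition at budget 0 follows from the one at [eps]: fewer points are reached at budget 0,
   and [term] provides an endpoint among them. *)
have minusP y : basin_minus F c B eps y <-> ends_inside F c B eps y.
  rewrite /basin_minus; case: eqP => [->//|_].
  split=> [[]//|yB]; split=> //; split; first exact: term.
  by move=> p [yp pF]; apply: yB.2; split=> //; exact: reach_le yp.
split; apply/seteqP; split=> // y.
- move=> _; have [yG|yNG] := pselect (basin F c G eps y); [by left|right].
  apply/minusP; split.
    have [p [yp pF]] := term y.
    by exists p; split=> //; exact: reach_le yp.
  move=> p [yp pF]; have : (G `|` B) p by rewrite GB_union.
  by case=> // Gp; case: yNG; exists p.
- case=> -[p [yp Gp]] /minusP[_ yB].
  have pF : ~ pdom F p by have : (G `|` B) p by [left]; rewrite GB_union.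
  by suff: (G `&` B) p; [rewrite GB_disj|split=> //; exact: yB].
Qed.

End Reach.

Lemma timeF_time (X : Type) (a b : nat) (f : X -> option X) (y z : DF a b f) :
  timeF a b f y = Some z -> val (val z).1 = (val (val y).1).+1.
Proof.
rewrite /timeF /prestrict /time_ext.
case: insubP => //= t' _ <-; case: (f _) => //= x'.
by case: insubP => //= w _ wE [<-]; rewrite wE.
Qed.

Theorem theorem3p4 (R : realType) (X : metricType R) (f : X -> option X)
    (a b : nat) (hab : (a < b)%N) (G B : set (DF a b f))
    (GB_union : G `|` B = final_slice a b f) (GB_disj : G `&` B = set0)
    (eps : R) (heps : 0 <= eps) :
  basin (timeF a b f) (time_cost a b f) G eps%:E
    `|` basin_minus (timeF a b f) (time_cost a b f) B eps%:E
    = [set: DF a b f] /\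
  basin (timeF a b f) (time_cost a b f) G eps%:E
    `&` basin_minus (timeF a b f) (time_cost a b f) B eps%:E
    = set0.
Proof.
apply: basin_partition => //; last by rewrite setC_pdom_timeF.
(* The measure is the time remaining until [b]. *)
apply: (@reach0_terminal _ _ _ _ (fun y => b - val (val y).1)%N).
  by move=> y; rewrite /time_cost eqxx mdistxx.
(* Truncated subtraction drops strictly only below [b]; the time of [y] is below [b] because that of
   its image [z] is at most [b]. *)
move=> y z /timeF_time zE; rewrite zE ltn_sub2l//.
by rewrite -zE; case/andP: (valP (val z).1).
Qed.
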